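(* There are infinitely many elliptic curves of the form $$E_t:\ y^2=x^3-(t^2-1)^2x+(t^2+1)^2,\qquad t\in\mathbb{Q},$$ with rank $\geq 3$; that is, there are infinitely many $t\in\mathbb{Q}$ for which $E_t$ is an elliptic curve over $\mathbb{Q}$ of rank at least $3$.
   Context: The rank of an elliptic curve $E$ over $\mathbb{Q}$ is the nonnegative integer $r$ such that $E(\mathbb{Q})\cong\mathbb{Z}^r\times E(\mathbb{Q})_{\mathrm{tors}}$. *)

(* Defs.v *)
From HB Require Import structures.
From mathcomp Require Import all_boot all_order all_algebra.
From mathcomp Require Import mathcomp_extra boolp classical_sets functions.
From mathcomp Require Import cardinality.
From mathcomp Require Import ring.

Set Implicit Arguments.
Unset Strict Implicit.
Unset Printing Implicit Defensive.

Import Order.TTheory GRing.Theory Num.Theory.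
Local Open Scope ring_scope.

Definition weierstrass_disc (F : fieldType) (a b : F) : F :=
  - 16%:R * (4%:R * a ^+ 3 + 27%:R * b ^+ 2).

(* The curve y^2 = x^3 + a x + b. A nonzero discriminant excludes
   characteristic 2, where this short form is always singular. *)
Record ellcurve (F : fieldType) := EllCurve {
  ec_a : F;
  ec_b : F;
  ec_disc_neq0 : weierstrass_disc ec_a ec_b != 0 }.

(* [None] is the point at infinity. *)
Definition on_curve (F : fieldType) (E : ellcurve F) (P : option (F * F)) :=
  if P is Some (x, y) then y ^+ 2 == x ^+ 3 + ec_a E * x + ec_b E else true.

Record ecpoint (F : fieldType) (E : ellcurve F) := ECPoint {
  ecpt : option (F * F);
  ecptP : on_curve E ecpt }.

HB.instance Definition _ (F : fieldType) (E : ellcurve F) :=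
  [isSub of ecpoint E for @ecpt F E].
HB.instance Definition _ (F : fieldType) (E : ellcurve F) :=
  [Choice of ecpoint E by <:].

Definition ec_opp_raw (F : fieldType) (P : option (F * F)) :=
  if P is Some (x, y) then Some (x, - y) else None.

(* For P <> -Q on the curve, the slope of the line through P and Q, which is
   the tangent line when P = Q. *)
Definition ec_slope (F : fieldType) (E : ellcurve F) (x1 y1 x2 y2 : F) : F :=
  if x1 == x2 then (3%:R * x1 ^+ 2 + ec_a E) / (2%:R * y1)
  else (y1 - y2) / (x1 - x2).

Definition ec_add_raw (F : fieldType) (E : ellcurve F)
    (P Q : option (F * F)) : option (F * F) :=
  match P, Q with
  | None, _ => Q
  | _, None => P
  | Some (x1, y1), Some (x2, y2) =>
    if (x1 == x2) && (y1 == - y2) then None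
    else
      let l := ec_slope E x1 y1 x2 y2 in
      let x3 := l ^+ 2 - x1 - x2 in
      Some (x3, l * (x1 - x3) - y1)
  end.

Lemma ec_two_neq0 (F : fieldType) (E : ellcurve F) : 2%:R != 0 :> F.
Proof.
apply: contra (ec_disc_neq0 E) => /eqP h2.
rewrite /weierstrass_disc (_ : 16%:R = 2%:R * 8%:R :> F); last by ring.
by rewrite h2 mul0r oppr0 mul0r.
Qed.

Lemma ec_opp_eq (F : fieldType) (E : ellcurve F) (y : F) : y = - y -> y = 0.
Proof.
move=> h; have /eqP : 2%:R * y = 0 by rewrite mulrDl mul1r {1}h addNr.
by rewrite mulf_eq0 (negPf (ec_two_neq0 E)) => /eqP.
Qed.

(* The two linear equations that characterize the slope, uniformly in the
   chord and tangent cases. *)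
Definition is_slope (F : fieldType) (E : ellcurve F) (x1 y1 x2 y2 l : F) :=
  y1 - y2 = l * (x1 - x2) /\
  l * (y1 + y2) = x1 ^+ 2 + x1 * x2 + x2 ^+ 2 + ec_a E.

Lemma is_slope_unique (F : fieldType) (E : ellcurve F) (x1 y1 x2 y2 l m : F) :
  ~~ ((x1 == x2) && (y1 == - y2)) ->
  is_slope E x1 y1 x2 y2 l -> is_slope E x1 y1 x2 y2 m -> l = m.
Proof.
rewrite negb_and => h [l1 l2] [m1 m2]; case/orP: h => h.
  by apply: (mulIf (_ : x1 - x2 != 0)); rewrite ?subr_eq0 // -l1 -m1.
by apply: (mulIf (_ : y1 + y2 != 0)); rewrite ?addr_eq0 // l2 m2.
Qed.

Lemma ec_slopeP (F : fieldType) (E : ellcurve F) (x1 y1 x2 y2 : F) :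
  on_curve E (Some (x1, y1)) -> on_curve E (Some (x2, y2)) ->
  ~~ ((x1 == x2) && (y1 == - y2)) ->
  is_slope E x1 y1 x2 y2 (ec_slope E x1 y1 x2 y2).
Proof.
move=> /= /eqP h1 /eqP h2; rewrite /ec_slope /is_slope.
have [e /= hy|ne _] := eqVneq x1 x2.
  subst x2; have: (y1 - y2) * (y1 + y2) = 0.
    by rewrite -subr_sqr h1 h2 subrr.
  move/eqP; rewrite mulf_eq0 subr_eq0 addr_eq0 (negPf hy) orbF => /eqP ey.
  subst y2; split; first by rewrite !subrr mulr0.
  have y0 : 2%:R * y1 != 0.
    rewrite mulf_neq0 ?(ec_two_neq0 E) //.
    by apply: contra hy => /eqP ->; rewrite oppr0.
  rewrite (_ : y1 + y1 = 2%:R * y1); last by ring.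
  by rewrite divfK //; ring.
have nz : x1 - x2 != 0 by rewrite subr_eq0.
split; first by rewrite divfK.
apply: (mulIf nz); rewrite mulrAC divfK // -subr_sqr h1 h2; ring.
Qed.

Lemma on_curve_third (F : fieldType) (E : ellcurve F) (x1 y1 x2 y2 l : F) :
  on_curve E (Some (x1, y1)) -> is_slope E x1 y1 x2 y2 l ->
  on_curve E (Some (l ^+ 2 - x1 - x2, l * (x1 - (l ^+ 2 - x1 - x2)) - y1)).
Proof.
move=> /= /eqP h1 [l1 l2]; apply/eqP.
have ey : y2 = y1 - l * (x1 - x2) by rewrite -l1; ring.
have eb : ec_b E = y1 ^+ 2 - x1 ^+ 3 - ec_a E * x1 by rewrite h1; ring.
have ea : ec_a E = l * (y1 + y2) - (x1 ^+ 2 + x1 * x2 + x2 ^+ 2).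
  by rewrite l2; ring.
rewrite eb ea ey; ring.
Qed.

Lemma ec_add_rawE (F : fieldType) (E : ellcurve F) (x1 y1 x2 y2 l : F) :
  on_curve E (Some (x1, y1)) -> on_curve E (Some (x2, y2)) ->
  ~~ ((x1 == x2) && (y1 == - y2)) -> is_slope E x1 y1 x2 y2 l ->
  ec_add_raw E (Some (x1, y1)) (Some (x2, y2)) =
  Some (l ^+ 2 - x1 - x2, l * (x1 - (l ^+ 2 - x1 - x2)) - y1).
Proof.
move=> h1 h2 h hl; rewrite /ec_add_raw (negPf h).
by rewrite (is_slope_unique h (ec_slopeP h1 h2 h) hl).
Qed.

Lemma ec_opp_subproof (F : fieldType) (E : ellcurve F) (P : ecpoint E) :
  on_curve E (ec_opp_raw (ecpt P)).
Proof. by case: P => -[[x y]|] //=; rewrite sqrrN. Qed.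

Lemma ec_add_subproof (F : fieldType) (E : ellcurve F) (P Q : ecpoint E) :
  on_curve E (ec_add_raw E (ecpt P) (ecpt Q)).
Proof.
case: P Q => -[[x1 y1]|] hP [[[x2 y2]|] hQ] //.
rewrite /ec_add_raw [ecpt _]/= [ecpt (ECPoint hQ)]/=.
case: ifPn => // h; exact: on_curve_third hP (ec_slopeP hP hQ h).
Qed.

Definition ec_zero (F : fieldType) (E : ellcurve F) : ecpoint E :=
  @ECPoint F E None isT.
Definition ec_opp (F : fieldType) (E : ellcurve F) (P : ecpoint E) :=
  ECPoint (ec_opp_subproof P).
Definition ec_add (F : fieldType) (E : ellcurve F) (P Q : ecpoint E) :=
  ECPoint (ec_add_subproof P Q).

Lemma ec_add0 (F : fieldType) (E : ellcurve F) :
  left_id (ec_zero E) (@ec_add F E).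
Proof. by move=> P; apply: val_inj. Qed.

Lemma ec_addN (F : fieldType) (E : ellcurve F) :
  left_inverse (ec_zero E) (@ec_opp F E) (@ec_add F E).
Proof.
by case=> -[[x y]|] hP; apply: val_inj => //=; rewrite !eqxx.
Qed.

Lemma is_slopeC (F : fieldType) (E : ellcurve F) (x1 y1 x2 y2 l : F) :
  is_slope E x1 y1 x2 y2 l -> is_slope E x2 y2 x1 y1 l.
Proof.
move=> [l1 l2]; split; first by rewrite -opprB l1; ring.
by rewrite addrC l2; ring.
Qed.

Lemma ec_addC (F : fieldType) (E : ellcurve F) : commutative (@ec_add F E).
Proof.
case=> -[[x1 y1]|] hP [[[x2 y2]|] hQ]; apply: val_inj => //.
have [h|h] := boolP ((x1 == x2) && (y1 == - y2)).
  by rewrite /= h; case/andP: h => /eqP -> /eqP ->; rewrite opprK !eqxx.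
have h' : ~~ ((x2 == x1) && (y2 == - y1)).
  by apply: contra h => /andP[/eqP -> /eqP ->]; rewrite opprK !eqxx.
have hl := ec_slopeP hP hQ h; set l := ec_slope _ _ _ _ _ in hl.
apply: etrans (ec_add_rawE hP hQ h hl) _; apply: esym.
apply: etrans (ec_add_rawE hQ hP h' (is_slopeC hl)) _.
congr (Some (_, _)); first by ring.
have -> : y2 = y1 - l * (x1 - x2) by rewrite -hl.1; ring.
ring.
Qed.

Lemma ec_addK (F : fieldType) (E : ellcurve F) (P Q : ecpoint E) :
  ec_add (ec_add P Q) (ec_opp Q) = P.
Proof.
case: Q => -[[x2 y2]|] hQ; last first.
  by case: P => -[[x1 y1]|] hP; apply: val_inj.
case: P => -[[x1 y1]|] hP; last first.
  by apply: val_inj; rewrite /= opprK !eqxx.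
have [h|h] := boolP ((x1 == x2) && (y1 == - y2)).
  by apply: val_inj; rewrite /= h; case/andP: h => /eqP -> /eqP ->.
have hl := ec_slopeP hP hQ h; set l := ec_slope _ _ _ _ _ in hl.
have hS := on_curve_third hP hl.
have -> : ec_add (ECPoint hP) (ECPoint hQ) = ECPoint hS.
  by apply: val_inj; exact: (ec_add_rawE hP hQ h hl).
case: (hl) => l1 l2.
set u := l ^+ 2 - x1 - x2 in hS *; set v := l * (x1 - u) - y1 in hS *.
have ey : y1 = y2 + l * (x1 - x2) by rewrite -l1; ring.
have ea : ec_a E = l * (y1 + y2) - (x1 ^+ 2 + x1 * x2 + x2 ^+ 2).
  by rewrite l2; ring.
have hQ' : on_curve E (Some (x2, - y2)) by rewrite /= sqrrN.
have hn : ~~ ((u == x2) && (v == - - y2)).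
  apply/negP => /andP[/eqP eu /eqP ev].
  have ev' : v = - y2 by rewrite /v eu ey; ring.
  have y0 : y2 = 0.
    by apply: (ec_opp_eq E); rewrite -ev' ev opprK.
  have el : l ^+ 2 = x1 + 2%:R * x2.
    have -> : l ^+ 2 = u + x1 + x2 by rewrite /u; ring.
    by rewrite eu; ring.
  have ea' : ec_a E = - 3%:R * x2 ^+ 2.
    rewrite ea ey y0 (_ : l * _ = l ^+ 2 * (x1 - x2)); last by ring.
    by rewrite el; ring.
  have eb : ec_b E = 2%:R * x2 ^+ 3.
    have /eqP e := hQ; rewrite (_ : ec_b E = x2 ^+ 3 + ec_a E * x2 + ec_b E
      - (x2 ^+ 3 + ec_a E * x2)); last by ring.
    by rewrite -e y0 ea'; ring.
  have /eqP[] := ec_disc_neq0 E.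
  by rewrite /weierstrass_disc ea' eb; ring.
have hm : is_slope E u v x2 (- y2) (- l).
  split; first by rewrite /v ey; ring.
  by rewrite ea /v /u ey; ring.
apply: val_inj; apply: etrans (ec_add_rawE hS hQ' hn hm) _.
by congr (Some (_, _)); rewrite /v /u; ring.
Qed.

Lemma ec_addKC (F : fieldType) (E : ellcurve F) (P Q : ecpoint E) :
  ec_add (ec_opp P) (ec_add P Q) = Q.
Proof. by rewrite ec_addC (ec_addC P) ec_addK. Qed.

Lemma ec_oppK (F : fieldType) (E : ellcurve F) : involutive (@ec_opp F E).
Proof. by case=> -[[x y]|] hP; apply: val_inj => //=; rewrite opprK. Qed.

Lemma ec_opp_neq (F : fieldType) (E : ellcurve F) (x1 y1 x2 y2 : F)
    (h1 : on_curve E (Some (x1, y1))) (h2 : on_curve E (Some (x2, y2))) :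
  ECPoint h1 <> ec_opp (ECPoint h2) -> ~~ ((x1 == x2) && (y1 == - y2)).
Proof.
by move=> h; apply/negP => /andP[/eqP ex /eqP ey]; apply/h/val_inj; rewrite /= ex ey.
Qed.

Lemma ec_addA_generic (F : fieldType) (E : ellcurve F) (P Q R : ecpoint E) :
  P <> ec_opp Q -> Q <> ec_opp R -> P <> R ->
  ec_add P Q <> ec_opp R -> P <> ec_opp (ec_add Q R) ->
  ec_add P (ec_add Q R) = ec_add (ec_add P Q) R.
Proof.
case: P => -[[x1 y1]|] hP; last by move=> *; apply: val_inj.
case: Q => -[[x2 y2]|] hQ; last by move=> *; apply: val_inj.
case: R => -[[x3 y3]|] hR; last first.
  have -> : ECPoint hR = ec_zero E by apply: val_inj.
  by move=> *; rewrite -!(ec_addC (ec_zero E)) !ec_add0.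
move=> /ec_opp_neq hPQ /ec_opp_neq hQR nPR.
have hl := ec_slopeP hP hQ hPQ; set l := ec_slope _ _ _ _ _ in hl.
have hm := ec_slopeP hQ hR hQR; set m := ec_slope _ _ _ _ _ in hm.
have hS := on_curve_third hP hl; have hT := on_curve_third hQ hm.
have -> : ec_add (ECPoint hP) (ECPoint hQ) = ECPoint hS.
  by apply: val_inj; exact: (ec_add_rawE hP hQ hPQ hl).
have -> : ec_add (ECPoint hQ) (ECPoint hR) = ECPoint hT.
  by apply: val_inj; exact: (ec_add_rawE hQ hR hQR hm).
move=> /ec_opp_neq hSR /ec_opp_neq hPT.
case: (hl) => l1 l2; case: (hm) => m1 m2.
have ey1 : y1 = y2 + l * (x1 - x2) by rewrite -l1; ring.
have ey3 : y3 = y2 + m * (x3 - x2).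
  by rewrite (_ : m * _ = - (m * (x2 - x3))); [rewrite -m1|]; ring.
have ea : ec_a E = l * (y1 + y2) - (x1 ^+ 2 + x1 * x2 + x2 ^+ 2).
  by rewrite l2; ring.
have ea' : ec_a E = m * (y2 + y3) - (x2 ^+ 2 + x2 * x3 + x3 ^+ 2).
  by rewrite m2; ring.
have e2 : 2%:R * y2 * (l - m) = (x1 - x3) * (x1 + x2 + x3)
    - l ^+ 2 * (x1 - x2) + m ^+ 2 * (x3 - x2).
  have : l * (y1 + y2) - (x1 ^+ 2 + x1 * x2 + x2 ^+ 2)
       = m * (y2 + y3) - (x2 ^+ 2 + x2 * x3 + x3 ^+ 2) by rewrite -ea -ea'.
  rewrite ey1 ey3 => e; apply/eqP; rewrite -subr_eq0.
  by move/eqP: e; rewrite -subr_eq0 => /eqP e; apply/eqP; rewrite -[RHS]e; ring.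
have lm : l - m != 0.
  apply/negP; rewrite subr_eq0 => /eqP elm.
  have : (x1 - x3) * (x1 + x2 + x3 - l ^+ 2) = 0.
    have : 2%:R * y2 * (l - m) = 0 by rewrite elm subrr mulr0.
    by rewrite e2 -elm => e; rewrite -[RHS]e; ring.
  move/eqP; rewrite mulf_eq0 !subr_eq0 => /orP[/eqP ex|/eqP es].
    by apply: nPR; apply: val_inj; rewrite /= ey1 ey3 elm ex.
  move/negP: hSR; apply; apply/andP.
  have ex : l ^+ 2 - x1 - x2 = x3 by rewrite -es; ring.
  by rewrite ex eqxx; split=> //; apply/eqP; rewrite ey1 ey3 elm; ring.
set d := (x1 - x3) / (l - m).
have ex1 : x1 = x3 + d * (l - m) by rewrite /d divfK //; ring.
have ey2 : 2%:R * y2 =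
    d * (x1 + x2 + x3) - l ^+ 2 * d - (l + m) * (x3 - x2).
  by apply: (mulIf lm); rewrite e2 ex1; ring.
have {}ey2 :
    y2 = (d * (x1 + x2 + x3) - l ^+ 2 * d - (l + m) * (x3 - x2)) / 2%:R.
  by rewrite -ey2 mulrC mulKf // (ec_two_neq0 E).
have two := ec_two_neq0 E.
have hn : is_slope E (l ^+ 2 - x1 - x2)
    (l * (x1 - (l ^+ 2 - x1 - x2)) - y1) x3 y3 (d - l).
  by split; rewrite ?ea ey1 ey3 ey2 ex1; field.
have hk : is_slope E x1 y1 (m ^+ 2 - x2 - x3)
    (m * (x2 - (m ^+ 2 - x2 - x3)) - y2) (d - m).
  by split; rewrite ?ea ey1 ey2 ex1; field.
apply: val_inj; apply: etrans (ec_add_rawE hP hT hPT hk) _.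
apply: etrans (esym (ec_add_rawE hS hR hSR hn)).
by congr (Some (_, _)); rewrite ?ey1 ?ey2 ex1; field.
Qed.

Lemma ec_oppD (F : fieldType) (E : ellcurve F) (P Q : ecpoint E) :
  ec_opp (ec_add P Q) = ec_add (ec_opp P) (ec_opp Q).
Proof.
have := ec_addKC (ec_add P Q) (ec_opp Q); rewrite ec_addK => h.
by rewrite -h [RHS]ec_addC ec_addK.
Qed.

Lemma ec_addA (F : fieldType) (E : ellcurve F) : associative (@ec_add F E).
Proof.
move=> P Q R.
have [->|nPQ] := pselect (P = ec_opp Q).
  by rewrite ec_addKC ec_addN ec_add0.
have [->|nQR] := pselect (Q = ec_opp R).
  by rewrite ec_addN ec_addC ec_add0 -{2}(ec_oppK R) ec_addK.
have [->|nPR] := pselect (P = R); first by rewrite ec_addC (ec_addC R).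
have [h|nSR] := pselect (ec_add P Q = ec_opp R).
  rewrite h ec_addN -(ec_oppK R) -h ec_oppD (ec_addC Q) (ec_addC (ec_opp P)).
  by rewrite -{2}(ec_oppK Q) (ec_addC (ec_opp Q)) ec_addK ec_addC ec_addN.
have [h|nPT] := pselect (P = ec_opp (ec_add Q R)).
  rewrite h ec_addN ec_oppD (ec_addC (ec_opp Q)) -{2}(ec_oppK Q) ec_addK.
  by rewrite ec_addN.
exact: ec_addA_generic.
Qed.

HB.instance Definition _ (F : fieldType) (E : ellcurve F) :=
  GRing.isZmodule.Build (ecpoint E)
    (@ec_addA F E) (@ec_addC F E) (@ec_add0 F E) (@ec_addN F E).

Definition torsion (A : zmodType) : {pred A} :=
  fun x => `[< exists n : nat, (0 < n)%N /\ x *+ n = 0 >].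

Lemma torsion_zmod_closed (A : zmodType) : zmod_closed (@torsion A).
Proof.
split; first by apply/asboolP; exists 1%N.
move=> x y /asboolP[n [n0 xn]] /asboolP[m [m0 ym]].
apply/asboolP; exists (n * m)%N; split; first by rewrite muln_gt0 n0.
by rewrite mulrnBl mulrnA xn mul0rn mulnC mulrnA ym mul0rn subrr.
Qed.

HB.instance Definition _ (A : zmodType) :=
  GRing.isZmodClosed.Build A (@torsion A) (@torsion_zmod_closed A).

Record torsion_sub (A : zmodType) := TorsionSub {
  torsion_val : A;
  torsion_valP : torsion_val \in @torsion A }.

HB.instance Definition _ (A : zmodType) :=
  [isSub of torsion_sub A for @torsion_val A].
HB.instance Definition _ (A : zmodType) := [Choice of torsion_sub A by <:].
HB.instance Definition _ (A : zmodType) :=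
  [SubChoice_isSubZmodule of torsion_sub A by <:].

Definition has_rank (A : zmodType) (r : nat) : Prop :=
  exists f : {additive ('rV[int]_r * torsion_sub A)%type -> A}, bijective f.

Lemma int_kernel (n s : nat) (M : 'M[int]_(n, s)) :
  (s < n)%N -> exists2 u : 'rV[int]_n, u != 0 & u *m M = 0.
Proof.
move=> lt_sn; pose MQ : 'M[rat]_(n, s) := map_mx intr M.
have : kermx MQ != 0.
  rewrite -mxrank_eq0 mxrank_ker subn_eq0 -ltnNge.
  exact: leq_ltn_trans (rank_leq_col _) lt_sn.
case/rowV0Pn => v /sub_kermxP vM v0.
pose D : int := \prod_j denq (v 0 j).
pose u : 'rV[int]_n := \row_i (numq (v 0 i) * \prod_(j | j != i) denq (v 0 j)).
have uE : map_mx intr u = D%:~R *: v.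
  apply/rowP => i; rewrite !mxE.
  have -> : D = denq (v 0 i) * \prod_(j | j != i) denq (v 0 j).
    by rewrite /D (bigD1 i).
  by rewrite !intrM numqE [RHS]mulrC mulrA.
have D0 : D != 0 by apply/prodf_neq0 => j _; rewrite denq_eq0.
exists u.
  apply: contra v0 => /eqP u0; move/eqP: uE; rewrite u0 map_mx0 eq_sym.
  by rewrite scaler_eq0 intr_eq0 (negPf D0).
have /matrixP uM : map_mx (intr : int -> rat) (u *m M) = 0.
  by rewrite map_mxM uE -scalemxAl vM scaler0.
apply/matrixP => i j; have := uM i j; rewrite !mxE => /eqP.
by rewrite intr_eq0 => /eqP.
Qed.

Lemma int_additive_kernel (n s : nat) (h : {additive 'rV[int]_n -> 'rV[int]_s}) :
  (s < n)%N -> exists2 u : 'rV[int]_n, u != 0 & h u = 0.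
Proof.
pose M : 'M[int]_(n, s) := \matrix_(i, j) h (delta_mx 0 i) 0 j.
move=> /(int_kernel M)[u u0 uM]; exists u => //.
rewrite -[RHS]uM mulmx_sum_row {1}(row_sum_delta u) raddf_sum.
apply: eq_bigr => i _.
rewrite -[u 0 i]intz !scaler_int raddfMz; congr (_ *~ _).
by apply/rowP => j; rewrite !mxE.
Qed.

Lemma free_le_rank (A : zmodType) (n r : nat) (g : {additive 'rV[int]_n -> A}) :
  injective g -> has_rank A r -> (n <= r)%N.
Proof.
move=> gI [f [f' fK f'K]]; rewrite leqNgt; apply/negP => lt_rn.
pose h (u : 'rV[int]_n) : 'rV[int]_r := (f' (g u)).1.
have f'B : {morph f' : x y / x - y}.
  by move=> x y; rewrite -{1}(f'K x) -{1}(f'K y) -raddfB fK.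
have hB : zmod_morphism h by move=> u v; rewrite /h raddfB f'B.
pose hA : {additive 'rV[int]_n -> 'rV[int]_r} :=
  HB.pack h (GRing.isZmodMorphism.Build _ _ h hB).
have [u /eqP u0 hu] := int_additive_kernel hA lt_rn; apply: u0.
have /asboolP[k [k0 tk]] := torsion_valP (f' (g u)).2.
have {}tk : (f' (g u)).2 *+ k = 0 by apply: val_inj; rewrite raddfMn.
have gu : g u = f (0, (f' (g u)).2).
  rewrite -[LHS]f'K [f' (g u)]surjective_pairing.
  by rewrite (_ : (f' (g u)).1 = 0) //; exact: hu.
have uk : u *+ k = 0.
  have ftk : (0, (f' (g u)).2) *+ k = 0 :> ('rV[int]_r * torsion_sub A)%type.
    by rewrite pairMnE tk mul0rn.
  by apply: gI; rewrite raddf0 raddfMn gu -raddfMn ftk raddf0.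
apply/rowP => j; have /rowP/(_ j)/eqP := uk.
by rewrite mulmxnE !mxE mulrn_eq0 eqn0Ngt k0 => /eqP.
Qed.

Lemma rank_has_free (A : zmodType) (n r : nat) :
  (n <= r)%N -> has_rank A r ->
  exists g : {additive 'rV[int]_n -> A}, injective g.
Proof.
move=> le_nr [f [f' fK _]].
pose g (u : 'rV[int]_n) := f (u *m (pid_mx n : 'M_(n, r)), 0).
have gB : zmod_morphism g.
  move=> u v; rewrite /g -raddfB; congr (f _).
  by rewrite mulmxBl -[in LHS](subrr (0 : torsion_sub A)).
pose gA : {additive 'rV[int]_n -> A} :=
  HB.pack g (GRing.isZmodMorphism.Build _ _ g gB).
exists gA.
move=> u v /(can_inj fK)[/(congr1 (mulmx^~ (pid_mx n : 'M_(r, n))))] /=.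
by rewrite -!mulmxA pid_mx_id // pid_mx_1 !mulmx1.
Qed.

Lemma has_rank_unique (A : zmodType) (r s : nat) :
  has_rank A r -> has_rank A s -> r = s.
Proof.
move=> hr hs; apply/eqP; rewrite eqn_leq; apply/andP; split.
  by have [g gI] := rank_has_free (leqnn r) hr; exact: free_le_rank gI hs.
by have [g gI] := rank_has_free (leqnn s) hs; exact: free_le_rank gI hr.
Qed.

(* The rank of A is at least n. When A has a rank r, as E(Q) does by the
   Mordell-Weil theorem, this means n <= r: see rank_geP. The first conjunct
   keeps the predicate from holding vacuously on a group without a rank. *)
Definition rank_ge (A : zmodType) (n : nat) : Prop :=
  (exists g : {additive 'rV[int]_n -> A}, injective g) /\
  (forall r, has_rank A r -> (n <= r)%N).

Lemma rank_geP (A : zmodType) (r n : nat) :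
  has_rank A r -> rank_ge A n <-> (n <= r)%N.
Proof.
move=> hr; split=> [[_ /(_ _ hr)] //|le_nr]; split; first exact: rank_has_free hr.
by move=> s /(has_rank_unique hr) <-.
Qed.

(* Main.v *)
From HB Require Import structures.
Require Import Defs.
From mathcomp Require Import all_boot all_order all_algebra.
From mathcomp Require Import classical_sets cardinality.
From mathcomp Require Import ring.

(** Every curve E_t carries the points P = (0, t^2+1) and Q = (t^2-1, t^2+1).
At x = 1 the right-hand side of the equation is 4t^2+1, so a third point
R = (1, z) appears as soon as z^2 = 4t^2+1. This conic is parametrized by
t = u/(1-u^2), z = (1+u^2)/(1-u^2).

Independence of P, Q, R comes from a descent modulo 2 that only looks at finite
fields. In an abelian group without 2-torsion, elements none of whose nonempty
subset sums is divisible by 2 are independent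
([subset_sums_independent]): in a relation between them all coefficients have to
be even, and the relation can be halved forever. Both conditions are
certified by reduction modulo a prime. The abscissa of a point of order 2 is a root of the
cubic a^3 + Aa + B, and a point with double of abscissa x has an abscissa a with
(3a^2+A)^2 = 4(x+2a)(a^3+Aa+B), a monic quartic equation. Rational roots of such
equations survive in the residue field, so it is enough to see that there are
none there ([no_two_torsion_of_reduction], [not_double_of_reduction]).

Three primes do the job. Modulo 3 with t = 0 the cubic has no root; modulo 5
with (t, z) = (0, 1) the quartics of P and R have no root; modulo 13 with
(t, z) = (8, 7) those of the other five sums have no root. These residues are
those of u = 0 modulo 3 and 5 and u = 2 modulo 13, which holds for every
u = 15(13k+1). As t determines u > 1, infinitely many t arise. *)

Set Implicit Arguments.
Unset Strict Implicit.
Unset Printing Implicit Defensive.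

Import GRing.Theory Num.Theory.

Local Open Scope ring_scope.
Local Open Scope classical_set_scope.

(** * Independence from subset sums *)

(** In a relation with coefficients [d], the terms with odd coefficients
sum to an element divisible by 2, so every [d i] is even; without 2-torsion the
halved relation holds too. Hence the coefficients of any relation are divisible
by all powers of 2. *)
Lemma subset_sums_independent (A : zmodType) (n : nat) (e : 'I_n -> A) :
  (forall S : A, S + S = 0 -> S = 0) ->
  (forall (b : pred 'I_n) (S : A), \sum_(i | b i) e i = S + S -> b =1 pred0) ->
  forall c : 'I_n -> int, \sum_i e i *~ c i = 0 -> forall i, c i = 0.
Proof.
move=> no2 nodbl c rel.
have half (d : 'I_n -> int) : \sum_i e i *~ d i = 0 ->
    exists2 h : 'I_n -> int, (forall i, d i = h i * 2) & \sum_i e i *~ h i = 0.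
  move=> reld; pose h i := (d i %/ 2)%Z; pose b i := (d i %% 2)%Z != 0.
  have dE i : d i = h i * 2 + b i.
    rewrite {1}(divz_eq (d i) 2) /h /b; congr (_ + _).
    have /andP[] : (0 <= (d i %% 2)%Z < 2) by rewrite modz_ge0 // ltz_pmod.
    by case: (d i %% 2)%Z => [[|[|m]]|m].
  have dS : (\sum_(i | b i) e i) + (\sum_i e i *~ h i) *+ 2 = 0.
    rewrite -[RHS]reld big_mkcond -sumrMnl -big_split /=.
    apply: eq_bigr => i _; rewrite [in RHS]dE mulrzDr mulrzA addrC.
    by case: (b i).
  have b0 : b =1 pred0.
    apply: (nodbl b (- \sum_i e i *~ h i)).
    by apply/eqP; rewrite -opprD -addr_eq0 -mulr2n dS.
  exists h; first by move=> i; rewrite [LHS]dE b0; exact: addr0.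
  by apply: no2; rewrite -mulr2n -[RHS]dS (eq_bigl _ _ b0) big_pred0_eq add0r.
have div2 k (d : 'I_n -> int) :
    \sum_i e i *~ d i = 0 -> forall i, (2 ^+ k %| d i)%Z.
  elim: k d => [|k IH] d reld i; first by rewrite expr0 dvd1z.
  by have [h -> /IH hk] := half d reld; rewrite exprSr dvdz_mul.
move=> i; apply/eqP; rewrite -absz_eq0; apply/negPn/negP; rewrite -lt0n => c0.
have := div2 `|c i|%N c rel i; rewrite dvdzE abszX /= => /(dvdn_leq c0).
by rewrite leqNgt ltn_expl.
Qed.

Lemma rank_ge_of_subset_sums (A : zmodType) (n : nat) (e : 'I_n -> A) :
  (forall S : A, S + S = 0 -> S = 0) ->
  (forall (b : pred 'I_n) (S : A), \sum_(i | b i) e i = S + S -> b =1 pred0) ->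
  rank_ge A n.
Proof.
move=> no2 nodbl.
pose g (c : 'rV[int]_n) := \sum_i e i *~ c 0 i.
have gB : zmod_morphism g.
  move=> c d; rewrite /g -sumrB; apply: eq_bigr => i _.
  by rewrite !mxE mulrzBr.
pose gA : {additive 'rV[int]_n -> A} :=
  HB.pack g (GRing.isZmodMorphism.Build _ _ g gB).
have gI : injective gA.
  apply: raddf_inj => c /= gc0; apply/rowP => i; rewrite mxE.
  exact: (subset_sums_independent no2 nodbl gc0).
by split; [exists gA | move=> r; exact: free_le_rank gI].
Qed.

(** * Places of the rational numbers *)

(** The place of the rationals with values in [F]: [q] is a quotient of integers
with invertible denominator in [F], and [r] is its image. A relation rather than
a function, because [q] may have a pole, as when [F] is 'F_p and p divides the
denominator of [q]. *)
Definition reduces (F : fieldType) (q : rat) (r : F) : Prop :=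
  exists m n : int,
    [/\ q = m%:~R / n%:~R, n%:~R != 0 :> F & r = m%:~R / n%:~R].

Lemma intr_rat_neq0 (F : fieldType) (n : int) :
  n%:~R != 0 :> F -> n%:~R != 0 :> rat.
Proof. by rewrite intr_eq0; apply: contra => /eqP ->. Qed.

Lemma reduces_int (F : fieldType) (m : int) : reduces m%:~R (m%:~R : F).
Proof. by exists m, 1; rewrite !divr1 oner_neq0. Qed.

Lemma reduces_nat (F : fieldType) (m : nat) : reduces m%:R (m%:R : F).
Proof. by have := reduces_int F m; rewrite -!pmulrn. Qed.

Lemma reduces0 (F : fieldType) : reduces 0 (0 : F).
Proof. exact: (reduces_nat F 0). Qed.

Lemma reduces1 (F : fieldType) : reduces 1 (1 : F).
Proof. exact: (reduces_nat F 1). Qed.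

Lemma reducesN (F : fieldType) (q : rat) (r : F) :
  reduces q r -> reduces (- q) (- r).
Proof.
by move=> [m [n [-> n0 ->]]]; exists (- m), n; rewrite !rmorphN !mulNr.
Qed.

Lemma reducesD (F : fieldType) (q q' : rat) (r r' : F) :
  reduces q r -> reduces q' r' -> reduces (q + q') (r + r').
Proof.
move=> [m [n [-> n0 ->]]] [m' [n' [-> n0' ->]]].
exists (m * n' + m' * n), (n * n'); rewrite !rmorphD !rmorphM /= mulf_neq0 //.
by rewrite -!addf_div ?intr_rat_neq0 // (@intr_rat_neq0 F).
Qed.

Lemma reducesM (F : fieldType) (q q' : rat) (r r' : F) :
  reduces q r -> reduces q' r' -> reduces (q * q') (r * r').
Proof.
move=> [m [n [-> n0 ->]]] [m' [n' [-> n0' ->]]].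
by exists (m * m'), (n * n'); rewrite !rmorphM /= mulf_neq0 // -!mulf_div.
Qed.

Lemma reducesX (F : fieldType) (q : rat) (r : F) (k : nat) :
  reduces q r -> reduces (q ^+ k) (r ^+ k).
Proof.
move=> qr; elim: k => [|k IH]; first exact: reduces1.
by rewrite !exprS; apply: reducesM.
Qed.

Lemma reducesV (F : fieldType) (q : rat) (r : F) :
  r != 0 -> reduces q r -> reduces q^-1 r^-1.
Proof.
move=> r0 [m [n [-> n0 rE]]]; exists n, m; rewrite rE !invf_div; split=> //.
by apply: contra r0; rewrite rE => /eqP ->; rewrite mul0r.
Qed.

Lemma reduces_eq0 (F : fieldType) (r : F) : reduces 0 r -> r = 0.
Proof.
move=> [m [n [/eqP + n0 ->]]]; rewrite eq_sym mulf_eq0 invr_eq0.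
rewrite (negPf (intr_rat_neq0 n0)) orbF intr_eq0 => /eqP ->.
by rewrite mul0r.
Qed.

Lemma reduces_neq0 (F : fieldType) (q : rat) (r : F) :
  reduces q r -> r != 0 -> q != 0.
Proof.
by move=> qr; apply: contra => /eqP q0; apply/eqP/reduces_eq0; rewrite -q0.
Qed.

Lemma reduces_inj (F : fieldType) (q : rat) (r s : F) :
  reduces q r -> reduces q s -> r = s.
Proof.
move=> qr /reducesN /(reducesD qr); rewrite subrr => /reduces_eq0.
exact: subr0_eq.
Qed.

(** Numerator and denominator are coprime, so by Bezout they do not both vanish
in [F]; if the denominator does, the inverse of [q] reduces to 0. *)
Lemma reduces_or_pole (F : fieldType) (q : rat) :
  (exists r : F, reduces q r) \/ (q != 0 /\ reduces q^-1 (0 : F)).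
Proof.
have [d0|d0] := eqVneq ((denq q)%:~R : F) 0; last first.
  left; exists ((numq q)%:~R / (denq q)%:~R), (numq q), (denq q).
  by rewrite divq_num_den.
have : coprimez (numq q) (denq q) by exact: coprime_num_den.
case/coprimezP => -[u v] /= /(congr1 (intr : int -> F)).
rewrite rmorphD !rmorphM /= d0 mulr0 addr0 => uN.
have N0 : (numq q)%:~R != 0 :> F.
  by apply/eqP => N0; move/eqP: uN; rewrite N0 mulr0 eq_sym oner_eq0.
right; split.
  by apply: contra N0 => /eqP q0; rewrite q0.
exists (denq q), (numq q); split=> //; last by rewrite d0 mul0r.
by rewrite -{1}(divq_num_den q) invf_div.
Qed.

(** Reduces an expression in terms of known reductions; what remains is that the
denominators do not vanish in the residue field. *)
Ltac reduce :=
  repeat first [ eassumption | apply: reduces0 | apply: reduces1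
               | apply: reduces_nat | apply: reducesN | apply: reducesX
               | apply: reducesD | apply: reducesM | apply: reducesV ].

(** * Halving points on an elliptic curve *)

(** With slope l = (3a^2+A)/(2b) of the tangent at (a, b), the double has
abscissa x = l^2 - 2a; substituting b^2 = a^3 + Aa + B gives the equation. *)
Lemma double_xcoord (F : fieldType) (E : ellcurve F) (S : ecpoint E) (x y : F) :
  ecpt (S + S) = Some (x, y) ->
  exists a, (3%:R * a ^+ 2 + ec_a E) ^+ 2 =
            4%:R * (x + 2%:R * a) * (a ^+ 3 + ec_a E * a + ec_b E).
Proof.
case: S => -[[a b]|] hS //=.
case: ifPn => [//|]; rewrite eqxx /= => nb [<- _]; exists a.
rewrite /ec_slope eqxx -(eqP hS).
have b0 : b != 0 by apply: contra nb => /eqP ->; rewrite oppr0.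
have two := ec_two_neq0 E.
by field; rewrite b0 two.
Qed.

Lemma two_torsion_xcoord (F : fieldType) (E : ellcurve F) (S : ecpoint E) :
  S + S = 0 -> S != 0 -> exists a, a ^+ 3 + ec_a E * a + ec_b E = 0.
Proof.
case: S => -[[a b]|] hS /(congr1 (@ecpt _ _)) //=.
case: ifPn => // /andP[_ /eqP bb] _ _; exists a; rewrite -(eqP hS).
by rewrite (ec_opp_eq E bb) expr0n.
Qed.

(** The equation of [double_xcoord] is monic of degree 4 in [a] (its leading
coefficient is 9 - 8), so a solution has no pole and its reduction is a
solution over [F]. *)
Lemma not_double_of_reduction (F : fieldType) (E : ellcurve rat)
    (P : ecpoint E) (x y : rat) (A B x0 : F) :
  reduces (ec_a E) A -> reduces (ec_b E) B -> reduces x x0 ->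
  (forall a : F, (3%:R * a ^+ 2 + A) ^+ 2 !=
                 4%:R * (x0 + 2%:R * a) * (a ^+ 3 + A * a + B)) ->
  ecpt P = Some (x, y) -> forall S : ecpoint E, P <> S + S.
Proof.
move=> rA rB rx noroot Pxy S PS.
have [a qa] : exists a, (3%:R * a ^+ 2 + ec_a E) ^+ 2 =
    4%:R * (x + 2%:R * a) * (a ^+ 3 + ec_a E * a + ec_b E).
  by apply: (@double_xcoord rat E S x y); rewrite -PS.
have [[r ra]|[a0 rc]] := reduces_or_pole F a.
  apply/negP: (noroot r); rewrite negbK; apply/eqP.
  apply: (@reduces_inj F ((3%:R * a ^+ 2 + ec_a E) ^+ 2)); first by reduce.
  by rewrite qa; reduce.
(* If [a] has a pole, the equation in terms of its inverse reduces to 9 = 8. *)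
set c := a^-1 in rc.
have qc : (3%:R + ec_a E * c ^+ 2) ^+ 2 =
    4%:R * (x * c + 2%:R) * (1 + ec_a E * c ^+ 2 + ec_b E * c ^+ 3).
  have -> : (3%:R + ec_a E * c ^+ 2) ^+ 2 =
          (3%:R * a ^+ 2 + ec_a E) ^+ 2 / a ^+ 4.
    by rewrite /c; field.
  by rewrite qa /c; field.
have e : (3%:R + A * 0 ^+ 2) ^+ 2 =
    4%:R * (x0 * 0 + 2%:R) * (1 + A * 0 ^+ 2 + B * 0 ^+ 3) :> F.
  apply: (@reduces_inj F ((3%:R + ec_a E * c ^+ 2) ^+ 2)); first by reduce.
  by rewrite qc; reduce.
have := oner_neq0 F; rewrite (_ : 1 = (3%:R + A * 0 ^+ 2) ^+ 2 -
    4%:R * (x0 * 0 + 2%:R) * (1 + A * 0 ^+ 2 + B * 0 ^+ 3)); last by ring.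
by rewrite e subrr eqxx.
Qed.

(** Same argument as for [not_double_of_reduction], with the monic cubic whose
roots are the abscissas of the points of order 2. *)
Lemma no_two_torsion_of_reduction (F : fieldType) (E : ellcurve rat) (A B : F) :
  reduces (ec_a E) A -> reduces (ec_b E) B ->
  (forall a : F, a ^+ 3 + A * a + B != 0) ->
  forall S : ecpoint E, S + S = 0 -> S = 0.
Proof.
move=> rA rB noroot S SS; apply/eqP; apply: contraT => S0.
have [a qa] := two_torsion_xcoord SS S0.
have [[r ra]|[a0 rc]] := reduces_or_pole F a.
  apply: contraNT (noroot r) => _; apply/eqP/(@reduces_eq0 F _).
  by rewrite -qa; reduce.
set c := a^-1 in rc.
have qc : 1 + ec_a E * c ^+ 2 + ec_b E * c ^+ 3 = 0.
  by rewrite -[RHS](mul0r (c ^+ 3)) -qa /c; field.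
have : 1 + A * 0 ^+ 2 + B * 0 ^+ 3 = 0 :> F.
  by apply: reduces_eq0; rewrite -qc; reduce.
move/eqP; rewrite (_ : 1 + A * 0 ^+ 2 + B * 0 ^+ 3 = 1); last by ring.
by rewrite oner_eq0.
Qed.

Lemma ec_add_chord (F : fieldType) (E : ellcurve F) (P Q : ecpoint E)
    (x1 y1 x2 y2 l : F) :
  ecpt P = Some (x1, y1) -> ecpt Q = Some (x2, y2) -> x1 != x2 ->
  (y1 - y2) / (x1 - x2) = l ->
  ecpt (P + Q) = Some (l ^+ 2 - x1 - x2, l * (x1 - (l ^+ 2 - x1 - x2)) - y1).
Proof.
move=> hP hQ nx lE.
by rewrite /= /ec_add_raw hP hQ /ec_slope (negPf nx) /= lE.
Qed.

(** * The points on the curves *)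

(** Turns a statement on all residues into a closed computation. *)
Lemma forall_Zp (p : nat) (P : pred 'I_p.+2) :
  all (fun i => P i%:R) (iota 0 p.+2) -> forall x : 'I_p.+2, P x.
Proof.
by move=> /allP h x; rewrite -[x]natr_Zp h // mem_iota /=.
Qed.

(** The prime 3 excludes 2-torsion, 5 shows that P and R are not divisible by 2,
and 13 shows it for Q, P + Q, P + R, Q + R and P + Q + R. *)
Lemma rank_ge3_of_reductions (t z : rat) (E : ellcurve rat) :
  ec_a E = - (t ^+ 2 - 1) ^+ 2 -> ec_b E = (t ^+ 2 + 1) ^+ 2 ->
  z ^+ 2 = 4%:R * t ^+ 2 + 1 ->
  reduces t (0 : 'F_3) -> reduces t (0 : 'F_5) -> reduces z (1 : 'F_5) ->
  reduces t (8%:R : 'F_13) -> reduces z (7%:R : 'F_13) ->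
  rank_ge (ecpoint E) 3.
Proof.
move=> aE bE zE t3 t5 z5 t13 z13.
have rA (F : fieldType) (r : F) (tr : reduces t r) :
    reduces (ec_a E) (- (r ^+ 2 - 1) ^+ 2).
  by rewrite aE; reduce.
have rB (F : fieldType) (r : F) (tr : reduces t r) :
    reduces (ec_b E) ((r ^+ 2 + 1) ^+ 2).
  by rewrite bE; reduce.
pose x0 := t ^+ 2 - 1; pose y0 := t ^+ 2 + 1.
(* t, t^2 - 1 and t^2 - 2 are nonzero since they are so modulo 13; this
   makes the chords below non-vertical. *)
have t0 : t != 0 by apply: reduces_neq0 t13 _.
have x00 : x0 != 0.
  by apply: (@reduces_neq0 'F_13 x0 (8%:R ^+ 2 - 1)) => //; rewrite /x0; reduce.
have x01 : x0 - 1 != 0.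
  apply: (@reduces_neq0 'F_13 _ (8%:R ^+ 2 - 1 - 1)) => //.
  by rewrite /x0; reduce.
have onP : on_curve E (Some (0, y0)) by rewrite /= aE bE /y0; apply/eqP; ring.
have onQ : on_curve E (Some (x0, y0)).
  by rewrite /= aE bE /y0 /x0; apply/eqP; ring.
have onR : on_curve E (Some (1, z)) by rewrite /= aE bE zE; apply/eqP; ring.
pose P := ECPoint onP; pose Q := ECPoint onQ; pose R := ECPoint onR.
have hP : ecpt P = Some (0, y0) by [].
have hQ : ecpt Q = Some (x0, y0) by [].
have hR : ecpt R = Some (1, z) by [].
(* P, Q and -(P + Q) lie on the horizontal line y = t^2 + 1. *)
have hPQ : ecpt (P + Q) = Some (- x0, - y0).
  rewrite (ec_add_chord (l := 0) hP hQ); first by congr (Some (_, _)); ring.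
    by rewrite eq_sym.
  by rewrite subrr mul0r.
have := ec_add_chord (l := z - y0) hP hR.
rewrite eq_sym oner_eq0 => /(_ isT) hPR.
have {}hPR := hPR ltac:(by field).
have := ec_add_chord (l := (z - y0) / (1 - x0)) hQ hR.
rewrite -subr_eq0 => /(_ x01) hQR.
have x01' : 1 - x0 != 0 by rewrite -oppr_eq0 opprB.
have {}hQR := hQR ltac:(by field; rewrite x01 x01').
have x0N1 : - x0 - 1 = - t ^+ 2 by rewrite /x0; ring.
have := ec_add_chord (l := (z + y0) / t ^+ 2) hPQ hR.
rewrite -subr_eq0 x0N1 oppr_eq0 expf_neq0 // => /(_ isT) hPQR.
have {}hPQR := hPQR ltac:(by field).
pose e (i : 'I_3) := nth 0 [:: P; Q; R] i.
apply: (@rank_ge_of_subset_sums _ _ e).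
  move=> S; apply: (no_two_torsion_of_reduction (rA _ _ t3) (rB _ _ t3)).
  by apply: forall_Zp; vm_compute.
have nd5 := not_double_of_reduction (rA _ _ t5) (rB _ _ t5).
have nd13 := not_double_of_reduction (rA _ _ t13) (rB _ _ t13).
have dP S : P <> S + S.
  apply: (nd5 _ _ _ _ _ _ hP); first by rewrite ?/x0 ?/y0; reduce.
  by apply: forall_Zp; vm_compute.
have dR S : R <> S + S.
  apply: (nd5 _ _ _ _ _ _ hR); first by rewrite ?/x0 ?/y0; reduce.
  by apply: forall_Zp; vm_compute.
have dQ S : Q <> S + S.
  apply: (nd13 _ _ _ _ _ _ hQ); first by rewrite ?/x0 ?/y0; reduce.
  by apply: forall_Zp; vm_compute.
have dPQ S : P + Q <> S + S.
  apply: (nd13 _ _ _ _ _ _ hPQ); first by rewrite ?/x0 ?/y0; reduce.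
  by apply: forall_Zp; vm_compute.
have dPR S : P + R <> S + S.
  apply: (nd13 _ _ _ _ _ _ hPR); first by rewrite ?/x0 ?/y0; reduce.
  by apply: forall_Zp; vm_compute.
have dQR S : Q + R <> S + S.
  apply: (nd13 _ _ _ _ _ _ hQR); first by rewrite ?/x0 ?/y0; reduce.
  by apply: forall_Zp; vm_compute.
have dPQR S : P + Q + R <> S + S.
  apply: (nd13 _ _ _ _ _ _ hPQR); first by rewrite ?/x0 ?/y0; reduce.
  by apply: forall_Zp; vm_compute.
move=> b S.
rewrite big_mkcond !big_ord_recl big_ord0 /e /= addr0 addrA.
set i0 := ord0; set i1 := lift _ _; set i2 := lift _ _.
case b0: (b i0); case b1: (b i1); case b2: (b i2); rewrite ?add0r ?addr0.
- by move/dPQR.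
- by move/dPQ.
- by move/dPR.
- by move/dP.
- by move/dQR.
- by move/dQ.
- by move/dR.
- move=> _ [[|[|[|//]]] lt_i3] /=.
  + by rewrite -b0; congr (b _); apply: val_inj.
  + by rewrite -b1; congr (b _); apply: val_inj.
  + by rewrite -b2; congr (b _); apply: val_inj.
Qed.

(** * The infinite family *)

Theorem theorem2p1 :
  infinite_set [set t : rat | exists E : ellcurve rat,
    [/\ ec_a E = - (t ^+ 2 - 1) ^+ 2,
        ec_b E = (t ^+ 2 + 1) ^+ 2 &
        rank_ge (ecpoint E) 3]].
Proof.
pose u (k : nat) : nat := (15 * (13 * k + 1))%N.
pose T (k : nat) : rat := (u k)%:R / (1 - (u k)%:R ^+ 2).
have u_gt1 k : (1 < u k)%N by rewrite /u addn1 mulnS.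
have den0 k : 1 - (u k)%:R ^+ 2 != 0 :> rat.
  by rewrite subr_eq0 eq_sym -natrX pnatr_eq1 (eqn_sqr _ 1) gtn_eqF.
(* u/(1-u^2) = v/(1-v^2) amounts to (u - v)(1 + uv) = 0. *)
have T_inj : injective T.
  move=> k l; rewrite /T => kl.
  have : ((u k)%:R - (u l)%:R) * (1 + (u k)%:R * (u l)%:R) = 0 :> rat.
    move/eqP: kl; rewrite eqr_div // -subr_eq0 => /eqP kl.
    by rewrite -[RHS]kl; ring.
  move/eqP; rewrite mulf_eq0 -natrM -[1]/(1%:R) -natrD pnatr_eq0 orbF.
  rewrite subr_eq0 eqr_nat /u eqn_pmul2l // eqn_add2r eqn_pmul2l //.
  by move/eqP.
move=> fin; apply: infinite_nat.
apply: (sub_finite_set _ (finite_preimage (in2W T_inj) fin)) => k _ /=.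
pose v : rat := (u k)%:R; pose z := (1 + v ^+ 2) / (1 - v ^+ 2).
have zE : z ^+ 2 = 4%:R * T k ^+ 2 + 1.
  by rewrite /z /T -/v; field; exact: den0.
have uF (F : fieldType) (r : F) : (u k)%:R = r -> reduces v r.
  by move=> <-; exact: reduces_nat.
have v3 : reduces v (0 : 'F_3).
  by apply: uF; rewrite /u natrM (_ : 15%:R = 0) ?mul0r //; apply/eqP.
have v5 : reduces v (0 : 'F_5).
  by apply: uF; rewrite /u natrM (_ : 15%:R = 0) ?mul0r //; apply/eqP.
have v13 : reduces v (2%:R : 'F_13).
  apply: uF; rewrite /u natrM natrD natrM (_ : 13%:R = 0); last exact/eqP.
  by rewrite mul0r; apply/eqP.
have rT (F : fieldType) (r : F) : 1 - r ^+ 2 != 0 -> reduces v r ->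
    reduces (T k) (r / (1 - r ^+ 2)).
  by move=> r0 vr; rewrite /T -/v; reduce.
have rz (F : fieldType) (r : F) : 1 - r ^+ 2 != 0 -> reduces v r ->
    reduces z ((1 + r ^+ 2) / (1 - r ^+ 2)).
  by move=> r0 vr; rewrite /z; reduce.
have t3 : reduces (T k) (0 : 'F_3).
  by rewrite (_ : 0 = 0 / (1 - 0 ^+ 2)); [apply: rT | apply/eqP].
have disc : weierstrass_disc (- (T k ^+ 2 - 1) ^+ 2) ((T k ^+ 2 + 1) ^+ 2) != 0.
  apply: (@reduces_neq0 'F_3 _
    (weierstrass_disc (- (0 ^+ 2 - 1) ^+ 2) ((0 ^+ 2 + 1) ^+ 2))) => //.
  by rewrite /weierstrass_disc; reduce.
exists (EllCurve disc); split=> //.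
apply: (@rank_ge3_of_reductions (T k) z) => //.
- by rewrite (_ : 0 = 0 / (1 - 0 ^+ 2)); [apply: rT | apply/eqP].
- by rewrite (_ : 1 = (1 + 0 ^+ 2) / (1 - 0 ^+ 2)); [apply: rz | apply/eqP].
- by rewrite (_ : 8%:R = 2%:R / (1 - 2%:R ^+ 2)); [apply: rT | apply/eqP].
- rewrite (_ : 7%:R = (1 + 2%:R ^+ 2) / (1 - 2%:R ^+ 2)); first exact: rz.
  exact/eqP.
Qed.
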